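(* Let $T$ be a bipartite graph with no isolated vertices and let $H$ be a tree on $h$ vertices. Then the following are equivalent: (1) $ex(n,T,H)=\Theta(n^{\alpha(T)})$; (2) for every minimum edge cover $\Gamma$ of $T$ there is a $U(\Gamma)$-set $U$ such that the $(U,h)$ blow-up of $T$ does not contain a copy of $H$; (3) for some minimum edge cover $\Gamma$ of $T$ there is a $U(\Gamma)$-set $U$ such that the $(U,h)$ blow-up of $T$ does not contain a copy of $H$.
   Context: For graphs $T$ and $H$ with no isolated vertices, $ex(n,T,H)$ denotes the maximum possible number of copies of $T$ in an $H$-free graph on $n$ vertices; $\Theta$ refers to growth in $n$ with $T,H$ fixed. $\alpha(T)$ is the size of a maximum independent set in $T$. An edge cover of $T$ is a set $\Gamma\subseteq E(T)$ such that every vertex of $T$ lies in some edge of $\Gamma$; it is minimum if it has the smallest possible number of edges. For an edge cover $\Gamma$, a set $U\subseteq V(T)$ is a $U(\Gamma)$-set if each connected component of $T\setminus U$ intersects exactly one edge of $\Gamma$ and the number of connected components of $T\setminus U$ equals $|\Gamma|$. For $U\subseteq V(T)$ and an integer $h$, the $(U,h)$ blow-up of $T$ is obtained by keeping the vertices of $U$ and replacing each connected component of $T\setminus U$ by $h$ vertex-disjoint copies of it, each joined to $U$ exactly as the original component is joined to $U$ in $T$. *)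

(* Defs.v *)
From HB Require Import structures.
From mathcomp Require Import all_boot.

Set Implicit Arguments.
Unset Strict Implicit.
Unset Printing Implicit Defensive.

(* Finite simple graphs on a fixed vertex set.                                *)
Record sgraph (V : finType) := SGraph {
  edges :> {set {set V}};
  _ : [forall e in edges, #|e| == 2] }.

HB.instance Definition _ (V : finType) := [isSub for @edges V].
HB.instance Definition _ (V : finType) := [Finite of sgraph V by <:].

Lemma graph_of_subproof (V : finType) (r : rel V) :
  [forall e in [set [set p.1; p.2] | p in [set p : V * V | (p.1 != p.2) && r p.1 p.2]],
     #|e| == 2].
Proof.
apply/forall_inP => e /imsetP[p]; rewrite inE => /andP[p12 _] ->.
by rewrite cards2 p12.
Qed.

(* r is symmetrised and its loops are dropped; r is only used below when it   *)
(* is already symmetric and irreflexive.                                      *)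
Definition graph_of (V : finType) (r : rel V) : sgraph V :=
  SGraph (graph_of_subproof r).

Section Graph.
Variables (V : finType) (G : sgraph V).

Definition adj : rel V := fun x y => [set x; y] \in edges G.

Definition no_isolated := forall x, exists y, adj x y.

Definition bipartite := exists A : {set V}, forall x y, adj x y -> (x \in A) != (y \in A).

Definition graph_connected := 0 < #|V| /\ forall x y, connect adj x y.

(* ucycle holds for the sequence [:: x; y] when x and y are adjacent: the     *)
(* genuine cycles are those with at least 3 vertices.                         *)
Definition acyclic := forall c : seq V, ucycle adj c -> size c < 3.

Definition is_tree := graph_connected /\ acyclic.

Definition independent (S : {set V}) := [forall x in S, forall y in S, ~~ adj x y].

Definition independence_number := \max_(S : {set V} | independent S) #|S|.

Definition edge_cover (Gamma : {set {set V}}) :=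
  (Gamma \subset edges G) && (cover Gamma == [set: V]).

Definition min_edge_cover (Gamma : {set {set V}}) :=
  edge_cover Gamma /\
  forall Gamma' : {set {set V}}, edge_cover Gamma' -> #|Gamma| <= #|Gamma'|.

Definition adj_minus (U : {set V}) : rel V :=
  fun x y => [&& x \notin U, y \notin U & adj x y].

(* Vertex sets of the connected components of G \ U.                          *)
Definition components_minus (U : {set V}) : {set {set V}} :=
  equivalence_partition (connect (adj_minus U)) (~: U).

Definition U_set (Gamma : {set {set V}}) (U : {set V}) :=
  (forall C : {set V}, C \in components_minus U ->
     #|[set e in Gamma | C :&: e != set0]| = 1) /\
  #|components_minus U| = #|Gamma|.

Definition blowup_vertex (U : {set V}) (h : nat) : finType :=
  ({x : V | x \in U} + {x : V | x \notin U} * 'I_h)%type.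

(* inr (x, i) is the vertex x in the i-th copy of its component of G \ U;     *)
(* adjacent vertices outside U lie in the same component, so the copies of    *)
(* all components can be indexed simultaneously.                              *)
Definition blowup_adj (U : {set V}) (h : nat) : rel (blowup_vertex U h) :=
  fun p q => match p, q with
  | inl u, inl v => adj (val u) (val v)
  | inl u, inr (y, _) => adj (val u) (val y)
  | inr (x, _), inl v => adj (val x) (val v)
  | inr (x, i), inr (y, j) => (i == j) && adj (val x) (val y)
  end.

Definition blowup (U : {set V}) (h : nat) : sgraph (blowup_vertex U h) :=
  graph_of (@blowup_adj U h).

End Graph.

Section Copies.
Variables (VT VG : finType) (T : sgraph VT) (G : sgraph VG).

Definition embedding (f : {ffun VT -> VG}) :=
  injectiveb f && [forall e in edges T, f @: e \in edges G].

(* A copy of T in G is a (not necessarily induced) subgraph of G isomorphic   *)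
(* to T, given by its vertex set and its edge set; embeddings that differ by  *)
(* an automorphism of T give the same copy.                                   *)
Definition copies : {set {set VG} * {set {set VG}}} :=
  [set (f @: [set: VT], [set f @: e | e : {set VT} in edges T])
     | f : {ffun VT -> VG} in embedding].

Definition contains := copies != set0.

End Copies.

Definition ex_number (VT VH : finType) (n : nat) (T : sgraph VT) (H : sgraph VH) : nat :=
  \max_(G : sgraph 'I_n | ~~ contains H G) #|copies T G|.

(* Main.v *)
(* An edge cover of a bipartite graph of minimum size has [alpha(T)] edges
   (Koenig), and an [H]-free graph has linearly many edges since a graph of
   minimum degree [#|VH|] contains the tree [H]; as a copy of [T] is determined
   by the images of the edges of the cover, [ex(n, T, H) = O(n ^ alpha(T))].

   If the [(U, h)] blow-up is [H]-free then so is the [(U, N)] blow-up for every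
   [N], and with [N] of order [n] it contains [N ^ #|Gamma|] copies of [T].

   Conversely, a positive proportion of all [#|Gamma|]-tuples of edges coming
   from copies of [T] yields, by the Erdos box theorem, many edges for each
   member of [Gamma] that can be chosen independently.  For each member of
   [Gamma] these edges can be taken to form a star or a matching; [U] is the set
   of vertices of [T] whose image does not depend on the choice.  An edge of [T]
   between two vertices outside [U] lying in different members of [Gamma] would
   produce a complete bipartite graph, hence [H]; so the components of [T \ U]
   are traces of the members of [Gamma], and the blow-up embeds in the graph. *)
Require Import Defs.
From mathcomp Require Import all_boot zify.

Set Implicit Arguments.
Unset Strict Implicit.
Unset Printing Implicit Defensive.

(** * Embeddings and trees *)

Lemma edge_card (V : finType) (G : sgraph V) (e : {set V}) :
  e \in edges G -> #|e| = 2.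
Proof. by case: G => E /= /forall_inP card_E /card_E/eqP. Qed.

Lemma adj_sym (V : finType) (G : sgraph V) : symmetric (adj G).
Proof. by move=> x y; rewrite /adj setUC. Qed.

Lemma adj_neq (V : finType) (G : sgraph V) (x y : V) : adj G x y -> x != y.
Proof. by move/edge_card; rewrite cards2; case: (x != y). Qed.

Lemma adj_graph_of (V : finType) (r : rel V) (x y : V) :
  adj (graph_of r) x y = (x != y) && (r x y || r y x).
Proof.
apply/imsetP/andP => [[[a b]] | [xy rxy]].
  rewrite inE /= => /andP[ab rab] E.
  have : a \in [set x; y] by rewrite E set21.
  have : b \in [set x; y] by rewrite E set22.
  rewrite !inE => /orP[]/eqP eb /orP[]/eqP ea; move: ab rab; rewrite eb ea ?eqxx //.
    by rewrite eq_sym => -> ->; rewrite orbT.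
  by move=> -> ->.
case/orP: rxy => r_xy; first by exists (x, y); rewrite ?inE //= xy.
by exists (y, x); rewrite ?inE /= 1?setUC // eq_sym xy.
Qed.

Lemma embeddingP (VT VG : finType) (T : sgraph VT) (G : sgraph VG)
    (f : {ffun VT -> VG}) :
  reflect (injective f /\ {homo f : x y / adj T x y >-> adj G x y})
          (embedding T G f).
Proof.
apply: (iffP andP) => [[/injectiveP f_inj /forall_inP f_edge]|[f_inj f_adj]].
  by split=> // x y xy; have := f_edge _ xy; rewrite imsetU1 imset_set1.
split; first exact/injectiveP.
apply/forall_inP=> e eT; have /eqP/cards2P[x [y [_ exy]]] := edge_card eT.
by rewrite exy imsetU1 imset_set1; apply: f_adj; rewrite /adj -exy.
Qed.

Lemma containsP (VT VG : finType) (T : sgraph VT) (G : sgraph VG) :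
  reflect (exists f : VT -> VG,
             injective f /\ {homo f : x y / adj T x y >-> adj G x y})
          (contains T G).
Proof.
apply: (iffP (set0Pn _)) => [[_ /imsetP[f /embeddingP f_emb _]]|[f [f_inj f_adj]]].
  by exists f.
eexists; apply: (imset_f _ (_ : [ffun x => f x] \in _)); apply/embeddingP.
by split=> [x y|x y]; rewrite !ffunE; [apply: f_inj | apply: f_adj].
Qed.

Lemma contains_trans (V1 V2 V3 : finType) (G1 : sgraph V1) (G2 : sgraph V2)
    (G3 : sgraph V3) : contains G1 G2 -> contains G2 G3 -> contains G1 G3.
Proof.
move=> /containsP[f [f_inj f_adj]] /containsP[g [g_inj g_adj]].
apply/containsP; exists (g \o f); split; first exact: inj_comp.
by move=> x y /f_adj/g_adj.
Qed.

Lemma leq_card_copies (VT VG : finType) (T : sgraph VT) (G : sgraph VG) :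
  #|copies T G| <= #|[set f | embedding T G f]|.
Proof. by rewrite cardsE; apply: leq_imset_card. Qed.

Lemma card_gt_notin (V : finType) (A B : {set V}) :
  #|B| < #|A| -> exists2 x, x \in A & x \notin B.
Proof.
move=> ltBA; apply/subsetPn; apply: contraL ltBA => /subset_leq_card.
by rewrite -leqNgt.
Qed.

(** If [x] and [x'] differed, a path between them inside [S] would close up through [y] to a
    cycle. *)
Lemma acyclic_no_second_neighbour (V : finType) (H : sgraph V) (S : {set V})
    (x x' y : V) :
  acyclic H ->
  connect (fun a b => [&& a \in S, b \in S & adj H a b]) x x' ->
  y \notin S -> x \in S -> adj H y x -> adj H y x' -> x = x'.
Proof.
move=> acH /connectP[p0 p0S ->] yS xS yx.
case/shortenP: p0S => p pS p_uniq _ yx'; case: p => [//|z p] in pS p_uniq yx' *.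
have p_adj : path (adj H) x (z :: p).
  by apply: sub_path pS => a b /and3P[].
have pin : {subset x :: z :: p <= S}.
  move: pS xS; elim: (z :: p) (x) => [|b q IH] a /=.
    by move=> _ aS c; rewrite inE => /eqP->.
  move=> /andP[/and3P[_ bS _] qS] aS c; rewrite inE => /predU1P[->//|].
  exact: IH.
have /acH : ucycle (adj H) [:: y, x, z & p].
  apply/andP; split.
    by move: p_adj yx'; rewrite /= yx rcons_path => /andP[-> ->] /=; rewrite adj_sym.
  by rewrite cons_uniq p_uniq andbT; apply: contra yS => /pin.
by [].
Qed.

Lemma greedy_tree (VH VG : finType) (H : sgraph VH) (G : sgraph VG) (W : {set VG}) :
  is_tree H -> W != set0 ->
  (forall x, x \in W -> #|VH| <= #|[set y in W | adj G x y]|) ->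
  contains H G.
Proof.
move=> [[/card_gt0P[h0 _] connH] acH] /set0Pn[w0 w0W] degW.
pose inS (S : {set VH}) a b := [&& a \in S, b \in S & adj H a b].
(* Keeping the embedded part connected makes [x] the only embedded neighbour of
   the next vertex [y]. *)
suff partial s : 0 < s <= #|VH| -> exists (S : {set VH}) (f : VH -> VG), #|S| = s /\
    {in S &, forall x y, connect (inS S) x y} /\ {in S &, injective f} /\
    (forall x, x \in S -> f x \in W) /\
    {in S &, forall x y, adj H x y -> adj G (f x) (f y)}.
  have [|S [f [cardS [_ [f_inj [_ f_adj]]]]]] := partial #|VH|.
    by rewrite leqnn andbT; apply/card_gt0P; exists h0.
  have ST x : x \in S.
    have -> : S = [set: VH] by apply/eqP; rewrite eqEcard subsetT cardsT cardS /=.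
    by [].
  by apply/containsP; exists f; split=> [x y|x y]; [apply: f_inj | apply: f_adj].
elim: s => [//|[|s] IH] sH.
  exists [set h0], (fun=> w0); rewrite cards1; split=> //; split; last split; last split.
  - by move=> x y /set1P-> /set1P->; exact: connect0.
  - by move=> x y /set1P-> /set1P->.
  - by [].
  - by move=> x y /set1P-> /set1P-> /adj_neq/eqP.
have [|S [f [cardS [connS [f_inj [fW f_adj]]]]]] := IH; first exact: ltnW.
have /set0Pn[x0 x0S] : S != set0 by rewrite -card_gt0 cardS.
have [x [y [xS yS xy]]] : exists x y, [/\ x \in S, y \notin S & adj H x y].
  have [z _ zS] : exists2 z, z \in [set: VH] & z \notin S.
    by apply: card_gt_notin; rewrite cardsT cardS.
  have [/existsP[x /existsP[y /and3P[? ? ?]]]|nE] := boolP [exists x, exists y,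
     [&& x \in S, y \notin S & adj H x y]]; first by exists x, y.
  have step a b : adj H a b -> a \in S -> b \in S.
    move=> ab aS; apply: contraNT nE => bS; apply/existsP; exists a.
    by apply/existsP; exists b; rewrite aS bS.
  have cl : closed (adj H) S.
    by move=> a b ab; apply/idP/idP; apply: step => //; rewrite adj_sym.
  by have := closed_connect cl (connH x0 z); rewrite x0S (negPf zS).
have [w] : exists2 w, w \in [set v in W | adj G (f x) v] & w \notin f @: S.
  apply: card_gt_notin; apply: leq_trans (degW _ (fW _ xS)).
  by apply: leq_trans sH; rewrite ltnS -cardS leq_imset_card.
rewrite inE => /andP[wW fxw] wf.
have neqy z : z \in S -> z == y = false.
  by move=> zS; apply: contraNF yS => /eqP <-.
exists (y |: S), (fun z => if z == y then w else f z).
rewrite cardsU1 yS cardS; split=> //.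
have mono a b : connect (inS S) a b -> connect (inS (y |: S)) a b.
  apply: connect_sub => c d /and3P[cS dS cd]; apply: connect1.
  by rewrite /inS !inE cS dS !orbT.
have cyx z : z \in S -> connect (inS (y |: S)) y z /\ connect (inS (y |: S)) z y.
  move=> zS; split.
    apply: connect_trans (mono _ _ (connS _ _ xS zS)); apply: connect1.
    by rewrite /inS !inE eqxx xS orbT adj_sym xy.
  apply: connect_trans (mono _ _ (connS _ _ zS xS)) _; apply: connect1.
  by rewrite /inS !inE eqxx xS orbT xy.
have only_x z : z \in S -> adj H y z -> x = z.
  move=> zS yz; apply: (@acyclic_no_second_neighbour _ H S x z y) => //.
    exact: connS.
  by rewrite adj_sym.
split; last split; last split.
- move=> a b /setU1P[->|aS] /setU1P[->|bS]; first exact: connect0.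
  + by case: (cyx _ bS).
  + by case: (cyx _ aS).
  + exact/mono/connS.
- move=> a b /setU1P[->|aS] /setU1P[->|bS]; rewrite ?eqxx ?neqy //.
  + by move=> wE; case/negP: wf; rewrite wE imset_f.
  + by move=> wE; case/negP: wf; rewrite -wE imset_f.
  + exact: f_inj.
- by move=> a /setU1P[->|aS]; rewrite ?eqxx ?neqy // fW.
- move=> a b /setU1P[->|aS] /setU1P[->|bS]; rewrite ?eqxx ?neqy //.
  + by move/adj_neq/eqP.
  + by move/(only_x _ bS) <-; rewrite adj_sym.
  + by rewrite adj_sym => /(only_x _ aS) <-.
  + exact: f_adj.
Qed.

(** Degeneracy: by [greedy_tree] each nonempty [W] has a vertex with fewer than [#|VH|] neighbours
    in [W]. Deleting it loses fewer than [2 * #|VH|] arcs, each edge being counted in both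
    directions. *)
Lemma tree_free_arcs (VH VG : finType) (H : sgraph VH) (G : sgraph VG) :
  is_tree H -> ~~ contains H G ->
  #|[set p : VG * VG | adj G p.1 p.2]| <= (2 * #|VH|) * #|VG|.
Proof.
move=> treeH freeG.
pose arcs (W : {set VG}) := [set p : VG * VG | [&& p.1 \in W, p.2 \in W & adj G p.1 p.2]].
suff arcs_le s (W : {set VG}) : #|W| = s -> #|arcs W| <= (2 * #|VH|) * s.
  rewrite -[#|VG|]cardsT; apply: leq_trans (arcs_le _ [set: VG] erefl).
  by apply: subset_leq_card; apply/subsetP=> p; rewrite !inE.
elim: s W => [|s IH] W cardW.
  rewrite (cards0_eq cardW) muln0 leqn0 cards_eq0; apply/eqP/setP=> p.
  by rewrite !inE.
have /exists_inP[w wW degw] : [exists w in W, #|[set y in W | adj G w y]| < #|VH|].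
  apply: contraNT freeG => /exists_inPn degW; apply: (@greedy_tree _ _ _ _ W) => //.
    by rewrite -card_gt0 cardW.
  by move=> x /degW; rewrite -leqNgt.
have {}IH : #|arcs (W :\ w)| <= (2 * #|VH|) * s.
  by apply: IH; move: cardW; rewrite (cardsD1 w) wW => -[].
set N := [set y in W | adj G w y] in degw.
have : arcs W \subset arcs (W :\ w) :|: [set (w, y) | y in N] :|: [set (y, w) | y in N].
  apply/subsetP=> -[a b]; rewrite !in_setU inE /= => /and3P[aW bW ab].
  have [aw|aw] := eqVneq a w.
    by rewrite aw (imset_f (pair w)) ?orbT // inE bW -aw.
  have [bw|bw] := eqVneq b w.
    by rewrite bw (imset_f (pair^~ w)) ?orbT // inE aW adj_sym -bw.
  by rewrite !inE /= aw bw aW bW ab.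
move/subset_leq_card => le1.
have [le2 _] := leq_card_setU (arcs (W :\ w) :|: [set (w, y) | y in N]) [set (y, w) | y in N].
have [le3 _] := leq_card_setU (arcs (W :\ w)) [set (w, y) | y in N].
have le4 := leq_imset_card (pair w) N; have le5 := leq_imset_card (pair^~ w) N.
have -> : 2 * #|VH| * s.+1 = 2 * #|VH| * s + #|VH| + #|VH| by lia.
apply: leq_trans le1 (leq_trans le2 (leq_add _ (leq_trans le5 (ltnW degw)))).
exact: leq_trans le3 (leq_add IH (leq_trans le4 (ltnW degw))).
Qed.

(** * Minimum edge covers of bipartite graphs *)

(** An edge contains at most one vertex of an independent set, so choosing a covering edge for each
    vertex of the set is injective. *)
Lemma leq_independence_edge_cover (V : finType) (T : sgraph V) (Gamma : {set {set V}}) :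
  edge_cover T Gamma -> independence_number T <= #|Gamma|.
Proof.
case/andP=> /subsetP GT /eqP covG; apply/bigmax_leqP=> S /forall_inP indS.
have /(_ _)/bigcupP/= in_edge x : x \in cover Gamma by rewrite covG inE.
pose e x := odflt set0 [pick e in Gamma | x \in e].
have eP x : e x \in Gamma /\ x \in e x.
  rewrite /e; case: pickP => [E /andP[] //|]; have [E EG xE] := in_edge x.
  by move/(_ E); rewrite EG xE.
have e_inj : {in S &, injective e}.
  move=> x y xS yS exy; apply: contraTeq (indS x xS) => xy.
  apply/forall_inPn; exists y => //; rewrite negbK /adj.
  have [/GT ET xe] := eP x; have [_] := eP y; rewrite -exy => ye.
  suff -> : [set x; y] = e x by [].
  apply/eqP; rewrite eqEcard subUset !sub1set xe ye cards2 xy /=.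
  by rewrite (edge_card ET).
rewrite -(card_in_imset e_inj); apply: subset_leq_card.
by apply/subsetP=> _ /imsetP[x _ ->]; case: (eP x).
Qed.

(* Rado's argument: a minimal set of arcs satisfying the deficiency form of
   Hall's condition is functional on [A]. *)
Lemma hall_functional_arcs (V : finType) (A : {set V}) (P : {set V * V}) (b d : nat) :
  let N (P : {set V * V}) (S : {set V}) := [set y | [exists x in S, (x, y) \in P]] in
  (forall S : {set V}, S \subset A -> #|S| + b <= #|N P S| + d) ->
  exists2 Q : {set V * V}, Q \subset P &
    #|A| + b <= #|N Q A| + d /\
    {in A, forall x y z, (x, y) \in Q -> (x, z) \in Q -> y = z}.
Proof.
move=> N hallP.
pose hall Q := [forall (S : {set V} | S \subset A), #|S| + b <= #|N Q S| + d].
have [Q] : {Q | minset hall Q & Q \subset P} by apply: minset_exists; exact/forall_inP.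
move=> /minsetP[/forall_inP hallQ minQ] QP; exists Q => //; split; first exact: hallQ.
move=> x xA y z xy xz; apply/eqP; apply: contraT => yz.
(* By minimality, deleting an arc at [x] violates the condition on some set, which must contain [x]
   for the deletion to matter. *)
have bad y0 : (x, y0) \in Q -> exists S : {set V},
    [/\ S \subset A, x \in S & #|N (Q :\ (x, y0)) S| + d < #|S| + b].
  move=> xy0; have /forall_inPn[S SA] : ~~ hall (Q :\ (x, y0)).
    apply/negP=> /minQ/(_ (subD1set _ _))/setP/(_ (x, y0)).
    by rewrite xy0 !inE eqxx.
  rewrite -ltnNge => ltS; exists S; split=> //.
  apply: contraLR ltS => xS; rewrite -leqNgt.
  suff <- : N Q S = N (Q :\ (x, y0)) S by exact: hallQ.
  apply/setP=> v; rewrite !inE; apply: eq_existsb => u; rewrite !inE xpair_eqE.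
  by have [->|//] := eqVneq u x; rewrite (negPf xS).
have [S1 [S1A xS1 lt1]] := bad _ xy; have [S2 [S2A xS2 lt2]] := bad _ xz.
have hU : #|S1 :|: S2| + b <= #|N Q (S1 :|: S2)| + d.
  by apply: hallQ; rewrite subUset S1A.
have hI : #|(S1 :&: S2) :\ x| + b <= #|N Q ((S1 :&: S2) :\ x)| + d.
  by apply: hallQ; apply: subset_trans S1A; rewrite subDset subsetU // subsetIl orbT.
(* Each deleted arc survives in the other arc set, and [x] lies in both [S1] and [S2], so no
   neighbour of the union is lost. *)
have sU : N Q (S1 :|: S2) \subset N (Q :\ (x, y)) S1 :|: N (Q :\ (x, z)) S2.
  apply/subsetP=> v; rewrite !inE => /exists_inP[u uS uv].
  have [ux | ux] := eqVneq u x; last first.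
    case/setUP: uS => uS; apply/orP; [left | right]; apply/exists_inP; exists u => //;
    by rewrite !inE xpair_eqE (negPf ux).
  rewrite ux in uv; have [vy | vy] := eqVneq v y; apply/orP; [right | left];
    apply/exists_inP; exists x => //; rewrite !inE xpair_eqE eqxx uv /= ?vy ?yz ?andbT //.
have sI : N Q ((S1 :&: S2) :\ x) \subset N (Q :\ (x, y)) S1 :&: N (Q :\ (x, z)) S2.
  apply/subsetP=> v; rewrite in_setI !inE => /exists_inP[u].
  rewrite !inE => /and3P[ux uS1 uS2] uv.
  by apply/andP; split; apply/exists_inP; exists u => //; rewrite !inE uv xpair_eqE (negPf ux).
(* Submodular count: removing [x] from the intersection costs 1, while the two strict inequalities
   gain 2. *)
have leU := subset_leq_card sU; have leI := subset_leq_card sI.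
have eqN := cardsUI (N (Q :\ (x, y)) S1) (N (Q :\ (x, z)) S2).
have eqS := cardsUI S1 S2; have := cardsD1 x (S1 :&: S2); rewrite inE xS1 xS2 /=.
have := leq_add (leq_add hU hI) (leq_add leU leI); have := leq_add lt1 lt2.
move: eqN eqS; clear; lia.
Qed.

(** A functional [Q] gives one edge per vertex of [A], and each vertex of [~: A] missed by [Q] gets
    an edge of its own. The deficiency bound on [N Q A] makes the total at most the independence
    number. *)
Lemma konig_edge_cover (V : finType) (T : sgraph V) :
  no_isolated T -> bipartite T ->
  exists2 Gamma, edge_cover T Gamma & #|Gamma| = independence_number T.
Proof.
move=> isoT [A bipA].
suff [Gamma covG leG] : exists2 Gamma, edge_cover T Gamma & #|Gamma| <= independence_number T.
  by exists Gamma => //; apply/eqP; rewrite eqn_leq leG leq_independence_edge_cover.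
pose P := [set p : V * V | (p.1 \in A) && adj T p.1 p.2].
pose N (P : {set V * V}) (S : {set V}) := [set y | [exists x in S, (x, y) \in P]].
(* [S] together with the vertices of [~: A] not adjacent to it is independent. *)
have hallP (S : {set V}) : S \subset A ->
    #|S| + #|~: A| <= #|N P S| + independence_number T.
  move=> SA; have indS : independent T (S :|: (~: A :\: N P S)).
    have inN x y : x \in S -> adj T x y -> y \in N P S.
      by move=> xS xy; rewrite inE; apply/exists_inP; exists x; rewrite // inE /= xy (subsetP SA).
    apply/forall_inP=> x xI; apply/forall_inP=> y yI; apply/negP=> xy.
    move: xI yI (bipA _ _ xy); rewrite !in_setU !in_setD !in_setC.
    case xS: (x \in S) => /=; first rewrite (inN _ _ xS xy) (subsetP SA _ xS) /= orbF.
      by move=> _ /(subsetP SA) ->.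
    case yS: (y \in S) => /=; last by move=> /andP[_ /negPf->] /andP[_ /negPf->].
    by rewrite (inN y x) // adj_sym.
  have := @leq_bigmax_cond _ (independent T) (fun S : {set V} => #|S|) _ indS.
  rewrite -/(independence_number T) cardsU.
  have -> : S :&: (~: A :\: N P S) = set0.
    apply/setP=> x; rewrite !inE; case xS: (x \in S) => //=.
    by rewrite (subsetP SA _ xS) andbF.
  have := cardsID (N P S) (~: A); have := subset_leq_card (subsetIr (~: A) (N P S)).
  rewrite cards0; move: #|_| #|_| #|_| #|_| #|_| (independence_number T) => *; lia.
have [Q QP [cardQ funQ]] := hall_functional_arcs hallP.
pose nb x := odflt x [pick y | adj T x y].
have nbP x : adj T x (nb x).
  by rewrite /nb; case: pickP => //= nadj; have [y] := isoT x; rewrite nadj.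
(* The default [nb x] serves the vertices of [A] at which no arc of [Q] starts. *)
pose g x := odflt (nb x) [pick y | (x, y) \in Q].
have QPE x y : (x, y) \in Q -> x \in A /\ adj T x y.
  by move/(subsetP QP); rewrite inE => /andP.
have gP x : adj T x (g x).
  by rewrite /g; case: pickP => [y /QPE[]|] //= _; exact: nbP.
exists ([set [set x; g x] | x in A] :|: [set [set y; nb y] | y in ~: A :\: N Q A]).
  apply/andP; split.
    by rewrite subUset; apply/andP; split; apply/subsetP=> _ /imsetP[x _ ->];
    [apply: gP | apply: nbP].
  apply/eqP/setP=> x; rewrite inE; apply/bigcupP.
  have [xA|xA] := boolP (x \in A).
    by exists [set x; g x]; rewrite ?set21 // in_setU (imset_f (fun x => [set x; g x])).
  have [xN|xN] := boolP (x \in N Q A); last first.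
    exists [set x; nb x]; rewrite ?set21 // in_setU (imset_f (fun x => [set x; nb x])) ?orbT //.
    by rewrite in_setD xN in_setC.
  move: xN; rewrite inE => /exists_inP[y yA yx].
  exists [set y; g y]; first by rewrite in_setU (imset_f (fun x => [set x; g x])).
  suff -> : g y = x by rewrite set22.
  by rewrite /g; case: pickP => [z /= yz|/(_ x)]; [apply: funQ yz yx | rewrite yx].
apply: leq_trans (leq_card_setU _ _) _.
apply: leq_trans (leq_add (leq_imset_card _ _) (leq_imset_card _ _)) _.
have NA : N Q A \subset ~: A.
  apply/subsetP=> y; rewrite !inE => /exists_inP[x xA /QPE[_ xy]].
  by have := bipA _ _ xy; rewrite xA; case: (y \in A).
have := cardsID (N Q A) (~: A); rewrite (setIidPr NA).
move: cardQ; rewrite -/(N Q A); move: #|_| #|_| #|_| #|_| (independence_number T) => *; lia.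
Qed.

Lemma card_min_edge_cover (V : finType) (T : sgraph V) (Gamma : {set {set V}}) :
  no_isolated T -> bipartite T -> min_edge_cover T Gamma ->
  #|Gamma| = independence_number T.
Proof.
move=> isoT bipT [covG minG]; apply/eqP; rewrite eqn_leq leq_independence_edge_cover // andbT.
by have [Gamma' /minG le <-] := konig_edge_cover isoT bipT.
Qed.

Lemma min_edge_cover_exists (V : finType) (T : sgraph V) :
  no_isolated T -> bipartite T -> exists Gamma, min_edge_cover T Gamma.
Proof.
move=> isoT bipT; have [Gamma covG cardG] := konig_edge_cover isoT bipT.
exists Gamma; split=> // Gamma' /leq_independence_edge_cover; by rewrite cardG.
Qed.

(** * The box theorem *)

Lemma leq_exp2rW (m n e : nat) : m <= n -> m ^ e <= n ^ e.
Proof. by move=> le_mn; case: e => [|e]; rewrite ?expn0 ?leq_exp2r. Qed.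

(** Pigeonhole for densities: restricting to a frequent value multiplies the constant [c] by
    [#|B|]. *)
Lemma pigeonhole_fiber (X D : finType) (Q : {set X}) (f : X -> D) (B : {set D})
    (c a : nat) :
  0 < a -> {in Q, forall x, f x \in B} -> a <= c * #|Q| ->
  exists2 d, d \in B & a <= (c * #|B|) * #|[set x in Q | f x == d]|.
Proof.
move=> a_gt0 fB le_a; apply/exists_inP; apply: contraLR le_a.
rewrite negb_exists_in -ltnNge => /forall_inP lt_a.
have cardQ : #|Q| = \sum_(d in B) #|[set x in Q | f x == d]|.
  rewrite -sum1_card (partition_big f (mem B)) //=; apply: eq_bigr => d _.
  by rewrite -sum1_card; apply: eq_bigl => x; rewrite inE.
have [B0 | [d0 d0B]] := set_0Vmem B.
  by rewrite cardQ B0 big_set0 muln0.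
have B_gt0 : 0 < #|B| by apply/card_gt0P; exists d0.
rewrite -(ltn_pmul2l B_gt0) mulnA [#|B| * c]mulnC cardQ big_distrr /=.
suff le_sum : \sum_(d in B) c * #|B| * #|[set x in Q | f x == d]| <= \sum_(d in B) a.-1.
  apply: leq_ltn_trans le_sum _.
  by rewrite sum_nat_const ltn_pmul2l // prednK.
by apply: leq_sum => d /lt_a; rewrite -ltnNge -(ltnS _ a.-1) prednK.
Qed.

Lemma subset_of_card (X : finType) (A : {set X}) (m : nat) :
  m <= #|A| -> exists2 B : {set X}, B \subset A & #|B| = m.
Proof.
rewrite -bin_gt0 -cards_draws => /card_gt0P[B].
by rewrite inE => /andP[BA /eqP]; exists B.
Qed.

(** Induction on the length: many tails extend by the same set [E] of first coordinates, and a box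
    of such tails is enlarged by the side [E]. Density is measured against an upper bound [N] of
    [#|X|], since arcs are only bounded in number. *)
Lemma box_lemma k c m : exists N0, forall N (X : finType) (S : {set k.-tuple X}),
  N0 <= N -> #|X| <= N -> N ^ k <= c * #|S| ->
  exists A : 'I_k -> {set X}, (forall i, m <= #|A i|) /\
    forall t : k.-tuple X, (forall i, tnth t i \in A i) -> t \in S.
Proof.
elim: k c m => [|k IH] c m.
  exists 0 => N X S _ _; rewrite expn0 => cS.
  have /set0Pn[t tS] : S != set0 by apply: contraTneq cS => ->; rewrite cards0 muln0.
  exists (fun=> set0); split=> [[]//|t' _]; by rewrite tuple0 -(tuple0 t).
(* A dense section has density at least [1 / (2c)], so among [M] of them a tail lies on average in
   at least [2 * m.+1]. *)
pose M := 4 * c * m.+1.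
(* [4 * c] is the density constant of the tails in [Q] below; [2 ^ M] counts the subsets of [Y], the
   values in the pigeonhole. *)
have [N1 boxIH] := IH (4 * c * 2 ^ M) m.
(* At least [N / (2c)] sections are dense; the bound [2 * c * M] makes this at least [M]. *)
exists (maxn 1 (maxn N1 (2 * c * M))) => N X S.
rewrite !geq_max => /and3P[N_gt0 leN1 leNM] leX leS.
pose sec x := [set t : k.-tuple X | [tuple of x :: t] \in S].
have cardS : #|S| = \sum_x #|sec x|.
  rewrite -sum1_card (partition_big (fun t : k.+1.-tuple X => thead t) predT) //=.
  apply: eq_bigr => x _; rewrite -sum1_card.
  rewrite (reindex_onto (fun t : k.-tuple X => [tuple of x :: t])
     (fun t : k.+1.-tuple X => [tuple of behead t])) /=; last first.
    by move=> t /andP[_ /eqP <-]; rewrite -tuple_eta.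
  apply: eq_bigl => t; rewrite inE theadE eqxx andbT.
  suff -> : [tuple of behead [tuple of x :: t]] == t by rewrite andbT.
  exact/eqP/val_inj.
have sec_le x : #|sec x| <= N ^ k.
  apply: leq_trans (max_card _) _; rewrite card_tuple; exact: leq_exp2rW.
have Nk_gt0 : 0 < N ^ k by rewrite expn_gt0 N_gt0.
have c_gt0 : 0 < c.
  by rewrite lt0n; apply: contraTneq leS => ->; rewrite mul0n -ltnNge expn_gt0 N_gt0.
(* A bounded number of dense sections suffices: averaging over them replaces
   the convexity argument. *)
pose good := [set x | N ^ k <= 2 * c * #|sec x|].
have /subset_of_card[Y Ygood cardY] : M <= #|good|.
  have le1 : 2 * c * #|S| <= \sum_x ((x \in good) * (2 * c * N ^ k) + N ^ k).
    rewrite cardS big_distrr /=; apply: leq_sum => x _.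
    case: (boolP (x \in good)) => [_|].
      by apply: leq_trans (leq_addr _ _); rewrite mul1n leq_mul2l sec_le orbT.
    by rewrite inE -ltnNge mul0n; exact: ltnW.
  have le2 : 2 * c * #|S| <= #|good| * (2 * c * N ^ k) + N * N ^ k.
    apply: leq_trans le1 _; rewrite big_split /= -big_distrl /= sum_nat_const.
    by rewrite -big_mkcond sum1_card leq_add // leq_mul2r leX orbT.
  rewrite expnS in leS.
  have : N * N ^ k <= (2 * c * #|good|) * N ^ k by nia.
  rewrite leq_pmul2r // => leN.
  have := leq_trans leNM leN; rewrite leq_pmul2l //; lia.
pose D (t : k.-tuple X) := [set x in Y | [tuple of x :: t] \in S].
have sumD : \sum_(t : k.-tuple X) #|D t| = \sum_(x in Y) #|sec x|.
  transitivity (\sum_(t : k.-tuple X) \sum_(x in Y) ([tuple of x :: t] \in S : nat)).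
    apply: eq_bigr => t _; rewrite -sum1_card big_mkcond [RHS]big_mkcond /=.
    by apply: eq_bigr => x _; rewrite inE; case: (x \in Y) => //=; case: ifP.
  rewrite exchange_big; apply: eq_bigr => x _; rewrite -sum1_card [RHS]big_mkcond /=.
  by apply: eq_bigr => t _; rewrite inE; case: (_ \in S).
pose Q := [set t : k.-tuple X | m < #|D t|].
have DY t : D t \subset Y by apply/subsetP=> x; rewrite inE => /andP[].
(* Tails outside [Q] account for at most half of the double count, and each tail in [Q] for at most
   [M]. *)
have leQ : N ^ k <= (4 * c) * #|Q|.
  have le1 : \sum_t #|D t| <= #|Q| * M + N ^ k * m.+1.
    have le_term (t : k.-tuple X) : #|D t| <= (t \in Q) * M + m.+1.
      rewrite inE; case: ltnP => [_|le]; last exact: leq_trans le _.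
      by apply: leq_trans (leq_addr _ _); rewrite mul1n -cardY subset_leq_card.
    apply: leq_trans (leq_sum _ (fun t _ => le_term t)) _.
    rewrite big_split /= -big_distrl /= -big_mkcond sum1_card sum_nat_const leq_add2l.
    rewrite leq_mul2r; apply/orP; right; rewrite card_tuple; exact: leq_exp2rW.
  have le2 : M * N ^ k <= 2 * c * \sum_t #|D t|.
    rewrite sumD big_distrr /= -cardY -sum_nat_const; apply: leq_sum => x xY.
    by have := subsetP Ygood x xY; rewrite inE.
  have : M * N ^ k <= 2 * c * (#|Q| * M + N ^ k * m.+1).
    by apply: leq_trans le2 _; rewrite leq_mul2l le1 orbT.
  have -> : M * N ^ k = 2 * c * m.+1 * N ^ k + 2 * c * m.+1 * N ^ k by rewrite /M; lia.
  have -> : 2 * c * (#|Q| * M + N ^ k * m.+1) =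
      2 * c * m.+1 * (4 * c * #|Q|) + 2 * c * m.+1 * N ^ k by rewrite /M; lia.
  by rewrite leq_add2r leq_pmul2l // !muln_gt0 c_gt0.
have [E _ leE] := pigeonhole_fiber (f := D) (B := powerset Y) Nk_gt0
  (fun t _ => etrans (in_set _ _) (DY t)) leQ.
rewrite card_powerset cardY in leE.
have [A [cardA boxA]] := boxIH _ _ _ leN1 leX leE.
exists (fun i => if unlift ord0 i is Some j then A j else E); split.
  move=> i; case: unliftP => [j _|_]; first exact: cardA.
  have /card_gt0P[t] : 0 < #|[set x in Q | D x == E]|.
    by rewrite lt0n; apply: contraTneq leE => ->; rewrite muln0 -ltnNge.
  by rewrite !inE => /andP[/ltnW le_m /eqP <-].
move=> t tA; have /boxA : forall i, tnth [tuple of behead t] i \in A i.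
  move=> i; have := tA (lift ord0 i); rewrite liftK tnth_behead.
  by have -> : inord i.+1 = lift ord0 i by apply: val_inj; rewrite /= inordK // ltnS.
rewrite !inE => /andP[_ /eqP DE]; have := tA ord0; rewrite unlift_none -DE inE => /andP[_].
by rewrite [t in _ -> t \in _]tuple_eta /thead.
Qed.

(** * From a grid of embeddings to a blow-up *)

(** A maximal matching of at least [m] arcs gives the third case. Otherwise at most [2 * m] vertices
    meet all of [A]; with two orientations there are at most [4 * m] classes, one containing a star
    of [m] arcs. *)
Lemma arc_sunflower (V : finType) (A : {set V * V}) (m : nat) :
  0 < m -> 4 * m * m <= #|A| ->
  exists2 B : {set V * V}, B \subset A & #|B| = m /\
    [\/ {in B &, forall p q, p.1 = q.1}, {in B &, forall p q, p.2 = q.2} |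
        {in B &, forall p q, p != q -> [/\ p.1 != q.1, p.2 != q.2 & p.1 != q.2]}].
Proof.
move=> m_gt0 leA.
pose apart (p q : V * V) := [&& p.1 != q.1, p.2 != q.2, p.1 != q.2 & p.2 != q.1].
pose matching (M : {set V * V}) :=
  (M \subset A) && [forall p in M, forall q in M, (p != q) ==> apart p q].
have [M] : {M | maxset matching M & set0 \subset M}.
  by apply: maxset_exists; rewrite /matching sub0set; apply/forall_inP=> p; rewrite inE.
case/maxsetP=> /andP[MA /forall_inP matM] maxM _.
have [/subset_of_card[B BM cardB]|ltM] := leqP m #|M|.
  exists B; first exact: subset_trans MA.
  split=> //; apply: Or33 => p q pB qB pq.
  have /forall_inP/(_ q (subsetP BM _ qB)) := matM p (subsetP BM _ pB).
  by rewrite pq => /and4P[].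
(* By maximality every arc of [A] meets the small vertex set [Z] of [M]. *)
pose Z := [set p.1 | p in M] :|: [set p.2 | p in M].
have meetZ p : p \in A -> (p.1 \in Z) || (p.2 \in Z).
  move=> pA; apply: contraT; rewrite negb_or => /andP[p1 p2].
  have apM q : q \in M -> apart p q /\ apart q p.
    move=> qM; rewrite /apart ![q.1 == _]eq_sym ![q.2 == _]eq_sym.
    have q1 : q.1 \in Z by rewrite inE imset_f.
    have q2 : q.2 \in Z by rewrite inE [X in _ || X]imset_f ?orbT.
    have neq x y : x \notin Z -> y \in Z -> x != y.
      by move=> xZ yZ; apply: contraNneq xZ => ->.
    by rewrite !neq.
  suff pM : p \in M by rewrite inE imset_f in p1.
  rewrite -(maxM (p |: M)) ?setU11 ?subsetUr // /matching subUset sub1set pA MA /=.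
  apply/forall_inP=> q /setU1P[->|qM]; apply/forall_inP=> r /setU1P[->|rM].
  - by rewrite eqxx.
  - by case: (apM _ rM) => ->; rewrite implybT.
  - by case: (apM _ qM) => _ ->; rewrite implybT.
  - by have /forall_inP/(_ r rM) := matM q qM.
have cardZ : #|Z| <= 2 * m.
  rewrite mul2n -addnn; apply: leq_trans (leq_card_setU _ _) _.
  by apply: leq_add; apply: leq_trans (leq_imset_card _ _) _; exact: ltnW.
(* [f] records a vertex of [Z] on the arc and its end, so a fibre is a star with a fixed
   orientation. *)
pose f p := if p.1 \in Z then (p.1, true) else (p.2, false).
have A_gt0 : 0 < #|A| by apply: leq_trans leA; rewrite !muln_gt0 m_gt0.
have fZ : {in A, forall p, f p \in setX Z [set: bool]}.
  by move=> p /meetZ; rewrite /f; case: ifP => pZ; rewrite in_setX in_setT andbT.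
have [|[z s] _ le_fiber] := pigeonhole_fiber (c := 1) A_gt0 fZ; first by rewrite mul1n.
have /subset_of_card[B Bf cardB] : m <= #|[set p in A | f p == (z, s)]|.
  rewrite mul1n cardsX cardsT card_bool in le_fiber.
  have := leq_trans leA le_fiber.
  move: cardZ m_gt0; move: #|Z| #|[set _ in _ | _]| => a b; clear; nia.
exists B; first by apply: subset_trans Bf _; apply/subsetP=> p; rewrite inE => /andP[].
split=> //; have Bz p : p \in B -> f p = (z, s).
  by move/(subsetP Bf); rewrite inE => /andP[_ /eqP].
case: s Bz {Bf le_fiber} => Bz; [apply: Or31 | apply: Or32] => p q /Bz + /Bz;
  by rewrite /f; do 2!case: ifP => // _; move=> [->] [->].
Qed.

(** [b i] lists the arcs available to the [i]-th edge, and every combined choice comes from an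
    embedding. These embeddings agree on [U] and glue to a map of the blow-up whose layer [a] uses
    the arcs [b i a]. *)
Lemma grid_blowup (VT VG VH : finType) (T : sgraph VT) (G : sgraph VG)
    (H : sgraph VH) (Gamma : {set {set VT}}) (k : nat) (u v : 'I_k -> VT)
    (b : 'I_k -> 'I_#|VH| -> VG * VG) :
  is_tree H -> 1 < #|VH| -> ~~ contains H G ->
  (forall i, adj T (u i) (v i)) -> (forall x, exists i, x \in [set u i; v i]) ->
  #|Gamma| = k -> Gamma = [set [set u i; v i] | i in 'I_k] ->
  (forall i, injective (b i)) ->
  (forall i, [\/ forall a c, (b i a).1 = (b i c).1, forall a c, (b i a).2 = (b i c).2 |
     forall a c, a != c ->
       [/\ (b i a).1 != (b i c).1, (b i a).2 != (b i c).2 & (b i a).1 != (b i c).2]]) ->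
  (forall j : 'I_k -> 'I_#|VH|, exists f : VT -> VG,
     [/\ injective f, {homo f : x y / adj T x y >-> adj G x y} &
         forall i, (f (u i), f (v i)) = b i (j i)]) ->
  exists2 U, U_set T Gamma U & contains (blowup T U #|VH|) G.
Proof.
move=> treeH h_gt1 freeG uvT cov cardG GammaE b_inj b_tri emb.
have h_gt0 := ltnW h_gt1.
pose o0 : 'I_#|VH| := Ordinal h_gt0; pose o1 : 'I_#|VH| := Ordinal h_gt1.
have [iota iotaP] := fin_all_exists cov.
(* The image of the endpoint [x] of the [i]-th edge when arc [a] is chosen. *)
pose w i x a := if x == u i then (b i a).1 else (b i a).2.
have wE j f i x : (forall i, (f (u i), f (v i)) = b i (j i)) ->
    x \in [set u i; v i] -> f x = w i x (j i) :> VG.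
  move=> fb; rewrite !inE /w -fb /=; have [->//|_ /= /eqP->//] := eqVneq.
pose U := [set x | [forall a, forall c, w (iota x) x a == w (iota x) x c]].
have memU x : (x \in U) = [forall a, forall c, w (iota x) x a == w (iota x) x c].
  by rewrite inE.
clearbody U.
have UP x a c : x \in U -> w (iota x) x a = w (iota x) x c.
  by rewrite memU => /forallP/(_ a)/forallP/(_ c)/eqP.
have constU x i a c : x \in U -> x \in [set u i; v i] -> w i x a = w i x c.
  move=> xU xi; have [f [_ _ fb]] := emb (fun=> a); have [g [_ _ gb]] := emb (fun=> c).
  rewrite -(wE _ _ _ _ fb xi) -(wE _ _ _ _ gb xi).
  by rewrite (wE _ _ _ _ fb (iotaP x)) (wE _ _ _ _ gb (iotaP x)) (UP _ a c).
(* Choices [a] at [x] and [c] at [y] occur in one embedding unless they compete for the same edge;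
   injectivity and adjacency are read off there. *)
have sel x y a c : iota x != iota y \/ a = c \/ x \in U \/ y \in U ->
    exists f, [/\ injective f, {homo f : x y / adj T x y >-> adj G x y},
      f x = w (iota x) x a & f y = w (iota y) y c].
  have main a' c' : iota x != iota y \/ a' = c' -> exists f, [/\ injective f,
      {homo f : x y / adj T x y >-> adj G x y}, f x = w (iota x) x a' & f y = w (iota y) y c'].
    move=> ac; have [f [f_inj f_adj fb]] := emb (fun i => if i == iota x then a' else c').
    exists f; split=> //; first by rewrite (wE _ _ _ _ fb (iotaP x)) eqxx.
    rewrite (wE _ _ _ _ fb (iotaP y)) eq_sym.
    by case: ac => [/negPf->|->]; rewrite // if_same.
  case=> [xy|[ac|[xU|yU]]]; [by apply: main; left | by apply: main; right | |].
    by rewrite (UP x a c xU); apply: main; right.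
  by rewrite (UP y c a yU); apply: main; right.
(* A vertex on a second edge [i] has its image fixed by the choice at [i] while the choice at
   [iota x] varies, so it lies in [U]. *)
have iota_uniq x i : x \notin U -> x \in [set u i; v i] -> i = iota x.
  move=> xU xi; apply/eqP; apply: contraNT xU => ix; rewrite memU.
  apply/forallP=> a; apply/forallP=> c; apply/eqP.
  have [f [_ _ fb]] := emb (fun i' => if i' == i then o0 else a).
  have [g [_ _ gb]] := emb (fun i' => if i' == i then o0 else c).
  have := wE _ _ _ _ fb xi; have := wE _ _ _ _ gb xi; rewrite eqxx => <-.
  rewrite (wE _ _ _ _ fb (iotaP x)) (wE _ _ _ _ gb (iotaP x)).
  by rewrite eq_sym (negPf ix).
have vNu i : (v i == u i) = false by rewrite eq_sym (negPf (adj_neq (uvT i))).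
have wu i a : w i (u i) a = (b i a).1 by rewrite /w eqxx.
have wv i a : w i (v i) a = (b i a).2 by rewrite /w vNu.
have freeVertex i : exists2 x, x \in [set u i; v i] & x \notin U.
  have [uU|uU] := boolP (u i \in U); last by exists (u i); rewrite ?set21.
  have [vU|vU] := boolP (v i \in U); last by exists (v i); rewrite ?set22.
  suff : o0 = o1 by [].
  apply: (b_inj i); rewrite [LHS]surjective_pairing [RHS]surjective_pairing.
  by rewrite -!wu -!wv (constU _ _ o0 o1 uU) ?set21 // (constU _ _ o0 o1 vU) ?set22.
have notU x : x \notin U -> exists a c, w (iota x) x a != w (iota x) x c.
  by rewrite memU => /forallPn[a /forallPn[c ac]]; exists a, c.
(* The moving end of a star takes distinct values because the arcs are distinct. *)
have w_inj x : x \notin U -> injective (w (iota x) x).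
  move=> xU; have [a0 [c0 ac0]] := notU x xU.
  move=> a c; apply: contra_eq => ac; move: ac0.
  rewrite /w; have [_ ac0|_ ac0] := eqVneq x (u (iota x)); case: (b_tri (iota x)) => tri.
  - by rewrite (tri a0 c0) eqxx in ac0.
  - apply: contraNneq ac => eq1; apply/eqP/(b_inj (iota x)).
    by rewrite [LHS]surjective_pairing [RHS]surjective_pairing eq1 (tri a c).
  - by case: (tri _ _ ac).
  - apply: contraNneq ac => eq2; apply/eqP/(b_inj (iota x)).
    by rewrite [LHS]surjective_pairing [RHS]surjective_pairing eq2 (tri a c).
  - by rewrite (tri a0 c0) eqxx in ac0.
  - by case: (tri _ _ ac).
(* Both ends move only in the matching case, where distinct arcs are disjoint. *)
have cross i a c : u i \notin U -> v i \notin U -> a != c ->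
    w i (u i) a != w i (v i) c.
  move=> uU vU ac.
  have eu := iota_uniq _ i uU (set21 _ _); have ev := iota_uniq _ i vU (set22 _ _).
  case: (b_tri i) => tri.
  - by have [a0 [c0]] := notU _ uU; rewrite -eu !wu (tri a0 c0) eqxx.
  - by have [a0 [c0]] := notU _ vU; rewrite -ev !wv (tri a0 c0) eqxx.
  - by rewrite wu wv; case: (tri _ _ ac).
have w_neq x y a c : x != y -> w (iota x) x a != w (iota y) y c.
  move=> xy; have [/sel[f [f_inj _ <- <-]]|/andP[/eqP ixy /and3P[ac xU yU]]] :
      (iota x != iota y \/ a = c \/ x \in U \/ y \in U) \/
      (iota x == iota y) && [&& a != c, x \notin U & y \notin U].
  - case: (eqVneq (iota x) (iota y)); last by left; left.
    case: (eqVneq a c); first by left; right; left.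
    case: (boolP (x \in U)); first by left; right; right; left.
    by case: (boolP (y \in U)); [left; right; right; right | right].
  - by rewrite (inj_eq f_inj).
  have := iotaP x; have := iotaP y; rewrite -ixy; move: (iota x) => i.
  rewrite !inE => /orP[]/eqP yE /orP[]/eqP xE.
  - by rewrite xE yE eqxx in xy.
  - by rewrite xE yE eq_sym; apply: cross; rewrite -?xE -?yE // eq_sym.
  - by rewrite xE yE; apply: cross; rewrite -?xE -?yE.
  - by rewrite xE yE eqxx in xy.
(* Independent choices make the image sets [X] and [Y] completely joined, and [greedy_tree] finds
   [H] in their union. *)
have iota_adj x y : x \notin U -> y \notin U -> adj T x y -> iota x = iota y.
  move=> xU yU xy; apply/eqP; apply: contraNT freeG => ixy.
  have acadj a c : adj G (w (iota x) x a) (w (iota y) y c).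
    by have [|f [_ f_adj <- <-]] := sel x y a c; [left | apply: f_adj].
  pose X := [set w (iota x) x a | a in 'I_#|VH|].
  pose Y := [set w (iota y) y a | a in 'I_#|VH|].
  apply: (@greedy_tree _ _ _ _ (X :|: Y)) => //.
    by apply/set0Pn; exists (w (iota x) x o0); rewrite inE imset_f.
  have cardX : #|X| = #|VH| by rewrite card_imset ?cardsT ?card_ord //; exact: w_inj.
  have cardY : #|Y| = #|VH| by rewrite card_imset ?cardsT ?card_ord //; exact: w_inj.
  move=> z /setUP[/imsetP[a _ ->]|/imsetP[c _ ->]].
    rewrite -[leqLHS]cardY; apply: subset_leq_card; apply/subsetP=> _ /imsetP[c _ ->].
    by rewrite !inE [X in _ || X]imset_f ?orbT //=.
  rewrite -[leqLHS]cardX; apply: subset_leq_card; apply/subsetP=> _ /imsetP[a _ ->].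
  by rewrite !inE imset_f //= adj_sym.
(* Adjacent vertices outside [U] share their edge of [Gamma]; distinct ones sharing an edge are its
   two ends. *)
have connE x y : x \notin U -> y \notin U -> connect (adj_minus T U) x y = (iota x == iota y).
  move=> xU yU; apply/idP/idP => [xy|/eqP ixy].
    have cl : closed (adj_minus T U) [pred z | iota z == iota x].
      by move=> z t /and3P[zU tU zt]; rewrite !inE (iota_adj z t).
    by have := closed_connect cl xy; rewrite !inE eqxx eq_sym => <-.
  have [->|xy] := eqVneq x y; first exact: connect0.
  apply: connect1; rewrite /adj_minus xU yU /=.
  have := iotaP x; have := iotaP y; rewrite -ixy !inE => /orP[]/eqP yE /orP[]/eqP xE.
  - by rewrite xE yE eqxx in xy.
  - by rewrite xE yE adj_sym uvT.
  - by rewrite xE yE uvT.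
  - by rewrite xE yE eqxx in xy.
pose comp i := [set x | (x \notin U) && (iota x == i)].
have compE : components_minus T U = [set comp i | i in 'I_k].
  apply/setP=> C; apply/imsetP/imsetP=> [[x xU ->]|[i _ ->]].
    exists (iota x) => //; apply/setP=> y; rewrite !inE; rewrite inE in xU.
    by case: (boolP (y \in U)) => //= yU; rewrite connE // eq_sym.
  have [x xi xU] := freeVertex i; exists x; first by rewrite inE.
  apply/setP=> y; rewrite !inE (iota_uniq _ _ xU xi).
  by case: (boolP (y \in U)) => //= yU; rewrite connE // eq_sym.
have comp_inj : injective comp.
  move=> i i' /setP ii'; have [x xi xU] := freeVertex i.
  have := ii' x; rewrite !inE xU /= -(iota_uniq _ _ xU xi) eqxx.
  by move/esym/eqP.
exists U.
  split; last by rewrite compE card_imset // cardG card_ord.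
  rewrite compE => _ /imsetP[i _ ->].
  suff -> : [set e in Gamma | comp i :&: e != set0] = [set [set u i; v i]] by rewrite cards1.
  apply/setP=> e; rewrite inE GammaE; apply/andP/set1P => [[/imsetP[i' _ ->]]|->].
    case/set0Pn=> x; rewrite !in_setI => /andP[]; rewrite inE => /andP[xU /eqP <-] xi'.
    by rewrite (iota_uniq _ _ xU xi').
  split; first exact: (imset_f (fun i => [set u i; v i])).
  have [x xi xU] := freeVertex i; apply/set0Pn; exists x.
  by rewrite in_setI xi andbT inE xU -(iota_uniq _ _ xU xi) eqxx.
apply/containsP.
exists (fun p : blowup_vertex U #|VH| => match p with
  | inl x => w (iota (val x)) (val x) o0
  | inr (x, a) => w (iota (val x)) (val x) a
  end).
split.
  move=> [[x xU]|[[x xU] a]] [[y yU]|[[y yU] c]] /= eqw.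
  - congr inl; apply: val_inj => /=; apply/eqP; apply: contraT => xy.
    by have := w_neq _ _ o0 o0 xy; rewrite eqw eqxx.
  - have xy : x != y by apply: contraNneq yU => <-.
    by have := w_neq _ _ o0 c xy; rewrite eqw eqxx.
  - have xy : x != y by apply: contraNneq xU => ->.
    by have := w_neq _ _ a o0 xy; rewrite eqw eqxx.
  - have exy : x = y.
      by apply/eqP; apply: contraT => xy; have := w_neq _ _ a c xy; rewrite eqw eqxx.
    subst y; have -> : a = c by exact: w_inj eqw.
    by congr (inr (_, _)); apply: val_inj.
have selT x y a c : iota x != iota y \/ a = c \/ x \in U \/ y \in U -> adj T x y ->
    adj G (w (iota x) x a) (w (iota y) y c).
  by move=> /sel[f [_ f_adj <- <-]] /f_adj.

set g := (X in {homo X : _ _ / _ >-> _}).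
suff g_adj p q : blowup_adj T p q -> adj G (g p) (g q).
  by move=> p q; rewrite adj_graph_of => /andP[_ /orP[/g_adj//|/g_adj]]; rewrite adj_sym.
(* Every adjacency of the blow-up has an end in [U] or stays in one layer, so [sel] applies. *)
case: p q => [[x xU]|[[x xU] a]] [[y yU]|[[y yU] c]] /=; try exact: selT; move=> xy.
- by apply: selT xy; right; right; left.
- by apply: selT xy; right; right; left.
- by apply: selT xy; right; right; right.
- by case/andP: xy => /eqP->; apply: selT; right; left.
Qed.

(** * Embeddings counted by tuples of arcs *)

Lemma edge_cover_enum (V : finType) (T : sgraph V) (Gamma : {set {set V}}) :
  edge_cover T Gamma ->
  exists u v : 'I_#|Gamma| -> V, [/\ forall i, adj T (u i) (v i),
    forall x, exists i, x \in [set u i; v i] &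
    Gamma = [set [set u i; v i] | i in 'I_#|Gamma|]].
Proof.
case/andP=> /subsetP GT /eqP covG.
have : forall i : 'I_#|Gamma|, exists p : V * V, enum_val i = [set p.1; p.2].
  move=> i; have /GT/edge_card/eqP/cards2P[x [y [_ ->]]] := enum_valP i.
  by exists (x, y).
move/fin_all_exists=> [p pE].
have GammaE : Gamma = [set [set (p i).1; (p i).2] | i in 'I_#|Gamma|].
  apply/setP=> e; apply/idP/imsetP => [eG|[i _ ->]]; last by rewrite -pE enum_valP.
  by exists (enum_rank_in eG e); rewrite -?pE ?enum_rankK_in.
exists (fun i => (p i).1), (fun i => (p i).2); split=> //.
  by move=> i; rewrite /adj -pE GT ?enum_valP.
move=> x; have : x \in cover Gamma by rewrite covG inE.
by case/bigcupP=> e eG xe; exists (enum_rank_in eG e); rewrite -pE enum_rankK_in.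
Qed.

(** A type of its own: in an [H]-free graph it has linear size, whereas tuples over all vertex pairs
    would be too sparse for [box_lemma]. *)
Definition arc (V : finType) (G : sgraph V) : finType :=
  {p : V * V | adj G p.1 p.2}.

Definition arc_tuples (VT VG : finType) (T : sgraph VT) (G : sgraph VG)
    (k : nat) (u v : 'I_k -> VT) : {set k.-tuple (arc G)} :=
  [set t | [exists f : {ffun VT -> VG}, embedding T G f &&
             [forall i, (f (u i), f (v i)) == val (tnth t i)]]].

(** Every vertex is an end of some listed edge, so the arcs determine the embedding. *)
Lemma leq_card_embedding_tuples (VT VG : finType) (T : sgraph VT) (G : sgraph VG)
    (k : nat) (u v : 'I_k -> VT) :
  (forall i, adj T (u i) (v i)) -> (forall x, exists i, x \in [set u i; v i]) ->
  #|[set f | embedding T G f]| <= #|arc_tuples T G u v|.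
Proof.
move=> uv cov.
pose of_tuple (f : {ffun VT -> VG}) (t : k.-tuple (arc G)) :=
  [forall i, (f (u i), f (v i)) == val (tnth t i)].
pose g f := [pick t | of_tuple f t].
have g_def f : embedding T G f -> exists2 t, g f = Some t & of_tuple f t.
  move=> /embeddingP[_ f_adj].
  have arcf i : adj G (f (u i), f (v i)).1 (f (u i), f (v i)).2 by apply: f_adj.
  rewrite /g; case: pickP => [t ft|nt]; first by exists t.
  have /forallPn[i] := negbT (nt [tuple exist _ (f (u i), f (v i)) (arcf i) | i < k]).
  by rewrite tnth_mktuple eqxx.
have g_inj : {in [set f | embedding T G f] &, injective g}.
  move=> f f'; rewrite !inE => /g_def[t -> /forallP ft] /g_def[t' -> /forallP ft'] [tt'].
  subst t'; apply/ffunP=> x; have [i] := cov x.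
  have := ft i; rewrite -(eqP (ft' i)) => /eqP[fu fv].
  by rewrite !inE => /orP[]/eqP->.
rewrite -(card_in_imset g_inj) -(card_imset (mem (arc_tuples T G u v)) (@Some_inj _)).
apply: subset_leq_card; apply/subsetP=> _ /imsetP[f + ->]; rewrite inE => f_emb.
have [t -> ft] := g_def f f_emb; apply: imset_f; rewrite inE.
by apply/existsP; exists f; rewrite f_emb.
Qed.

Lemma tree_free_card_arc (VH VG : finType) (H : sgraph VH) (G : sgraph VG) :
  is_tree H -> ~~ contains H G -> #|{: arc G}| <= 2 * #|VH| * #|VG|.
Proof. by move=> treeH freeG; rewrite card_sig -cardsE (tree_free_arcs treeH). Qed.

Lemma leq_card_copies_tree_free (VT VH VG : finType) (T : sgraph VT) (H : sgraph VH)
    (G : sgraph VG) (Gamma : {set {set VT}}) :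
  is_tree H -> ~~ contains H G -> edge_cover T Gamma ->
  #|copies T G| <= (2 * #|VH| * #|VG|) ^ #|Gamma|.
Proof.
move=> treeH freeG /edge_cover_enum[u [v [uv cov _]]].
apply: leq_trans (leq_card_copies T G) _.
apply: leq_trans (leq_card_embedding_tuples G uv cov) _.
apply: leq_trans (max_card _) _; rewrite card_tuple.
by apply: leq_exp2rW; apply: tree_free_card_arc freeG.
Qed.

Lemma blowup_of_many_embeddings (VT VH : finType) (T : sgraph VT) (H : sgraph VH)
    (Gamma : {set {set VT}}) (c : nat) :
  is_tree H -> 1 < #|VH| -> edge_cover T Gamma ->
  exists n0, forall (VG : finType) (G : sgraph VG), n0 <= #|VG| ->
    ~~ contains H G -> #|VG| ^ #|Gamma| <= c * #|copies T G| ->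
    exists2 U, U_set T Gamma U & contains (blowup T U #|VH|) G.
Proof.
move=> treeH h_gt1 covG; have [u [v [uv cov GammaE]]] := edge_cover_enum covG.
have h_gt0 := ltnW h_gt1; set h := #|VH| in h_gt0 *; set k := #|Gamma| in u v uv cov GammaE *.
(* The box theorem is used with [N = 2 * h * #|VG|], whence the factor [(2 * h) ^ k]; sides of size
   [4 * h * h] let [arc_sunflower] extract [h] arcs. *)
have [n0 box] := box_lemma k ((2 * h) ^ k * c) (4 * h * h).
exists n0 => VG G le_n0 freeG le_copies.
have [|||A [cardA boxA]] := box (2 * h * #|VG|) (arc G) (arc_tuples T G u v).
- by apply: leq_trans le_n0 _; rewrite leq_pmull // muln_gt0.
- exact: tree_free_card_arc freeG.
- rewrite expnMn -mulnA leq_mul2l; apply/orP; right; apply: leq_trans le_copies _.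
  rewrite leq_mul2l; apply/orP; right; apply: leq_trans (leq_card_copies T G) _.
  exact: leq_card_embedding_tuples.
have : forall i, exists B : {set arc G}, [/\ B \subset A i, #|B| = h &
   [\/ {in B &, forall p q, (val p).1 = (val q).1}, {in B &, forall p q, (val p).2 = (val q).2} |
       {in B &, forall p q, p != q -> [/\ (val p).1 != (val q).1, (val p).2 != (val q).2 &
          (val p).1 != (val q).2]}]].
  move=> i; have cardAi : 4 * h * h <= #|val @: A i| by rewrite (card_imset _ val_inj).
  have [B BA [cardB triB]] := arc_sunflower h_gt0 cardAi.
  exists [set p | val p \in B]; split.
  - apply/subsetP=> p; rewrite inE => /(subsetP BA)/imsetP[q qA /val_inj->//].
  - rewrite -cardB -(card_imset _ val_inj); congr #|pred_of_set _|; apply/setP=> p.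
    apply/imsetP/idP=> [[q + ->]|pB]; first by rewrite inE.
    by have /imsetP[q _ pq] := subsetP BA p pB; exists q => //; rewrite inE -pq.
  - case: triB => triB; [apply: Or31|apply: Or32|apply: Or33] => p q;
      rewrite !inE => pB qB; [exact: triB|exact: triB|].
    by move=> pq; apply: triB.
move/fin_all_exists=> [B BP].
have cardB i : #|B i| = h by case: (BP i).
pose b i (j : 'I_h) := val (enum_val (cast_ord (esym (cardB i)) j)).
have b_in i (j : 'I_h) : enum_val (cast_ord (esym (cardB i)) j) \in B i by exact: enum_valP.
have b_inj i : injective (b i).
  by move=> j j' /val_inj/enum_val_inj/cast_ord_inj.
apply: (@grid_blowup VT VG VH T G H Gamma k u v b) => //.
- move=> i; case: (BP i) => _ _ [] triB; [apply: Or31|apply: Or32|apply: Or33] => a a'.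
  + exact: triB.
  + exact: triB.
  + by move=> aa'; apply: triB => //; rewrite -(inj_eq val_inj) (inj_eq (b_inj i)).
move=> j; have := boxA [tuple enum_val (cast_ord (esym (cardB i)) (j i)) | i < k].
have tA i : tnth [tuple enum_val (cast_ord (esym (cardB i)) (j i)) | i < k] i \in A i.
  by rewrite tnth_mktuple; case: (BP i) => /subsetP BA _ _; apply: BA.
move/(_ tA); rewrite inE => /existsP[f /andP[/embeddingP[f_inj f_adj] /forallP fb]].
by exists f; split=> // i; rewrite (eqP (fb i)) tnth_mktuple.
Qed.

(** * Copies in blow-ups *)

Lemma blowup_adj_sym (V : finType) (T : sgraph V) (U : {set V}) (h : nat) :
  symmetric (@blowup_adj V T U h).
Proof.
by move=> [x|[x a]] [y|[y c]] /=; rewrite adj_sym // eq_sym.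
Qed.

Lemma adj_blowup (V : finType) (T : sgraph V) (U : {set V}) (h : nat)
    (p q : blowup_vertex U h) : adj (blowup T U h) p q = (p != q) && blowup_adj T p q.
Proof. by rewrite adj_graph_of [blowup_adj T q p]blowup_adj_sym orbb. Qed.

(* A copy of [H] in a blow-up meets at most [#|VH|] layers. *)
Lemma contains_blowup (VT VH : finType) (T : sgraph VT) (H : sgraph VH)
    (U : {set VT}) (N : nat) :
  contains H (blowup T U N) -> contains H (blowup T U #|VH|).
Proof.
case/containsP=> f [f_inj f_adj].
pose layer (p : blowup_vertex U N) := if p is inr (_, i) then Some i else None.
(* A layer is named by a vertex of [H] mapped into it. For the layer of [f z] the default is never
   reached, so the name depends on the layer alone. *)
pose rank z i := enum_rank (odflt z [pick z' | layer (f z') == Some i]).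
pose g z : blowup_vertex U #|VH| :=
  match f z with inl x => inl x | inr (x, i) => inr (x, rank z i) end.
have rankP z i : layer (f z) = Some i -> layer (f (enum_val (rank z i))) = Some i.
  rewrite /rank enum_rankK => zi; case: pickP => [z' /eqP //|/(_ z)].
  by rewrite zi eqxx.
have rankE z z' i : layer (f z) = Some i -> layer (f z') = Some i -> rank z i = rank z' i.
  by rewrite /rank => zi zi'; case: pickP => [//|/(_ z)]; rewrite zi eqxx.
have g_inj : injective g.
  move=> z z'; rewrite /g; move: (rankP z) (rankP z').
  case fz: (f z) => [x|[x i]]; case fz': (f z') => [x'|[x' i']] //= r r' [].
    by move=> xx'; apply: f_inj; rewrite fz fz' xx'.
  move=> xx' rr'; apply: f_inj; rewrite fz fz' xx'.
  by have := r' i' erefl; rewrite -rr' (r i erefl) => -[->].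
apply/containsP; exists g; split=> // z z' zz'; rewrite adj_blowup (inj_eq g_inj) (adj_neq zz') /=.
have := f_adj z z' zz'; rewrite adj_blowup => /andP[_]; rewrite /g.
move: (@rankE z z'); case: (f z) => [x|[x i]]; case: (f z') => [x'|[x' i']] //= rE.
by case/andP=> /eqP ii' ->; rewrite andbT -ii' in rE *; rewrite (rE i).
Qed.

(** Copies forget automorphisms of [T]; distinct vertex sets are what tells the members of the
    family apart. *)
Lemma leq_card_copies_family (I VT VG : finType) (T : sgraph VT) (G : sgraph VG)
    (F : I -> VT -> VG) :
  (forall c, injective (F c)) -> (forall c, {homo F c : x y / adj T x y >-> adj G x y}) ->
  injective (fun c => F c @: [set: VT]) -> #|I| <= #|copies T G|.
Proof.
move=> F_inj F_adj F_img.
pose copy c := (F c @: [set: VT], [set F c @: e | e : {set VT} in edges T]).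
have copy_inj : injective copy by move=> c c' [/F_img].
rewrite -cardsT -(card_imset _ copy_inj); apply: subset_leq_card.
apply/subsetP=> _ /imsetP[c _ ->]; apply/imsetP; exists [ffun x => F c x].
  apply/embeddingP; split=> x y; rewrite !ffunE; [exact: F_inj | exact: F_adj].
congr pair; first by apply: eq_imset => x; rewrite ffunE.
by apply: eq_imset => e; apply: eq_imset => x; rewrite ffunE.
Qed.

(** Padding with isolated vertices creates no copy of [H]: each vertex of [H] has a neighbour, so it
    lands in the image of [io]. *)
Lemma extend_to_ordinal (V VH : finType) (G : sgraph V) (H : sgraph VH) (n : nat) :
  no_isolated H -> #|V| <= n ->
  exists (G' : sgraph 'I_n) (io : V -> 'I_n),
    [/\ injective io, {homo io : x y / adj G x y >-> adj G' x y} &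
        contains H G' -> contains H G].
Proof.
move=> isoH leVn; pose io (x : V) := widen_ord leVn (enum_rank x).
have io_inj : injective io by move=> x y /(congr1 val) /= /val_inj/enum_rank_inj.
pose r x y := [exists p, exists q, [&& io p == x, io q == y & adj G p q]].
exists (graph_of r), io; split=> //.
  move=> p q pq; rewrite adj_graph_of (inj_eq io_inj) (adj_neq pq) /=.
  by apply/orP; left; apply/existsP; exists p; apply/existsP; exists q; rewrite !eqxx.
case/containsP=> f [f_inj f_adj].
have adjP x y : adj (graph_of r) x y -> exists p q, [/\ x = io p, y = io q & adj G p q].
  rewrite adj_graph_of => /andP[_] /orP[]/existsP[p /existsP[q /and3P[/eqP<- /eqP<- pq]]].
    by exists p, q.
  by exists q, p; rewrite adj_sym.
have : forall z, exists p, f z = io p.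
  by move=> z; have [z' /f_adj/adjP[p [q [-> _ _]]]] := isoH z; exists p.
move/fin_all_exists=> [g fg]; apply/containsP; exists g; split.
  by move=> z z' gz; apply: f_inj; rewrite !fg gz.
by move=> z z' /f_adj/adjP[p [q []]]; rewrite !fg => /io_inj-> /io_inj->.
Qed.

Lemma card_blowup_vertex (V : finType) (U : {set V}) (N : nat) :
  0 < N -> #|{: blowup_vertex U N}| <= #|V| * N.
Proof.
move=> N_gt0; rewrite card_sum card_prod !card_sig card_ord.
have := cardC (mem U); rewrite (eq_card (_ : [predC mem U] =i [pred x | x \notin U])) //.
move=> <-; rewrite mulnDl leq_add2r; exact: leq_pmulr.
Qed.

(** Each component of [T \ U] is sent independently to one of [N] layers, and the vertex set of the
    resulting copy reveals all the choices. *)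
Lemma leq_ex_number (VT VH : finType) (T : sgraph VT) (H : sgraph VH) (U : {set VT})
    (n N : nat) :
  no_isolated H -> ~~ contains H (blowup T U #|VH|) -> 0 < N -> #|VT| * N <= n ->
  N ^ #|components_minus T U| <= ex_number n T H.
Proof.
move=> isoH freeU N_gt0 leN.
have [G [io [io_inj io_adj GH]]] := extend_to_ordinal (blowup T U N) isoH
  (leq_trans (card_blowup_vertex U N_gt0) leN).
have freeG : ~~ contains H G by apply: contra freeU => /GH/contains_blowup.
have := @leq_bigmax_cond _ (fun G : sgraph 'I_n => ~~ contains H G)
  (fun G : sgraph 'I_n => #|copies T G|) _ freeG.
rewrite -/(ex_number n T H); apply: leq_trans.
pose C x := [set y in ~: U | connect (adj_minus T U) x y].
have C_in (x : {x | x \notin U}) : C (val x) \in components_minus T U.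
  by apply: imset_f; rewrite inE (valP x).
pose compS x : {D | D \in components_minus T U} := exist _ (C (val x)) (C_in x).
pose F (c : {ffun {D | D \in components_minus T U} -> 'I_N}) x : blowup_vertex U N :=
  match boolP (x \in U) with
  | AltTrue xU => inl (exist _ x xU)
  | AltFalse xU => inr (exist _ x xU, c (compS (exist _ x xU)))
  end.
have F_inj c : injective (F c).
  by move=> x y; rewrite /F; case: {-}_ / boolP => ?; case: {-}_ / boolP => ? // [].
have adjm_sym : connect_sym (adj_minus T U).
  by apply: sym_connect_sym => x y; rewrite /adj_minus adj_sym andbCA.
have F_adj c : {homo F c : x y / adj T x y >-> adj (blowup T U N) x y}.
  move=> x y xy; rewrite adj_blowup (inj_eq (F_inj c)) (adj_neq xy) /= /F.
  case: {-}_ / boolP => xU; case: {-}_ / boolP => yU //=.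
  rewrite xy andbT; apply/eqP; congr (c _); apply: val_inj => /=.
  apply/setP=> z; rewrite !inE; congr (_ && _); apply: same_connect => //.
  by apply: connect1; rewrite /adj_minus xU yU.
have -> : N ^ #|components_minus T U| = #|{ffun {D | D \in components_minus T U} -> 'I_N}|.
  by rewrite card_ffun card_ord card_sig.
apply: (@leq_card_copies_family _ _ _ T G (fun c => io \o F c)) => [c|c|c c' cc'].
- exact: inj_comp io_inj (F_inj c).
- by move=> x y xy; exact: io_adj (F_adj c x y xy).
(* A vertex [x] of [D] occurs in the image only in layer [c D], so equal images force equal
   choices. *)
apply/ffunP=> -[D DP]; have /imsetP[x xU DE] := DP.
rewrite inE in xU; pose sx : {x | x \notin U} := exist _ x xU.
have -> : exist _ D DP = compS sx by apply: val_inj.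
have F_x d : F d x = inr (sx, d (compS sx)).
  rewrite /F; case: {-}_ / boolP => xU'; first by case: (negP xU xU').
  by congr (inr (_, d _)); apply: val_inj.
have : io (F c x) \in (io \o F c') @: [set: VT] by rewrite -cc' (imset_f (io \o F c)) ?inE.
case/imsetP=> y _ /= /io_inj; rewrite F_x /F; case: {-}_ / boolP => yU // [xy ->].
by congr (c' _); apply: val_inj; rewrite /= xy.
Qed.

(** * Growth of [ex_number] *)

(** A maximum over no graphs would be 0, so positivity provides a graph attaining it. *)
Lemma ex_number_witness (VT VH : finType) (n : nat) (T : sgraph VT) (H : sgraph VH) :
  0 < ex_number n T H ->
  exists2 G : sgraph 'I_n, ~~ contains H G & ex_number n T H = #|copies T G|.
Proof.
move=> ex_gt0; have [free_gt0|] := posnP #|[pred G : sgraph 'I_n | ~~ contains H G]|.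
  by rewrite /ex_number big_pred0 // in ex_gt0 => G; exact: (card0_eq free_gt0 G).
by case/(eq_bigmax_cond (fun G => #|copies T G|)) => G; exists G.
Qed.

Lemma leq_ex_number_pow (VT VH : finType) (n : nat) (T : sgraph VT) (H : sgraph VH) :
  no_isolated T -> bipartite T -> is_tree H ->
  ex_number n T H <= (2 * #|VH|) ^ independence_number T * n ^ independence_number T.
Proof.
move=> isoT bipT treeH; have [Gamma minG] := min_edge_cover_exists isoT bipT.
have cardG := card_min_edge_cover isoT bipT minG.
apply/bigmax_leqP=> G freeG.
have := leq_card_copies_tree_free treeH freeG minG.1.
by rewrite card_ord cardG expnMn.
Qed.

Lemma leq_pow_ex_number (VT VH : finType) (T : sgraph VT) (H : sgraph VH)
    (Gamma : {set {set VT}}) (U : {set VT}) :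
  no_isolated H -> U_set T Gamma U -> ~~ contains H (blowup T U #|VH|) ->
  forall n, #|VT| < n -> n ^ #|Gamma| <= (2 * #|VT|.+1) ^ #|Gamma| * ex_number n T H.
Proof.
move=> isoH [_ cardU] freeU n lt_n; set d := #|VT|.+1.
(* The blow-up with [n %/ d] layers fits into [n] vertices; as the quotient is positive,
   [n <= 2 * d * (n %/ d)]. *)
have N_gt0 : 0 < n %/ d by rewrite divn_gt0.
have le_n : #|VT| * (n %/ d) <= n.
  by apply: leq_trans (leq_trunc_div n d); rewrite mulnC leq_mul2l leqnSn orbT.
have := leq_ex_number isoH freeU N_gt0 le_n; rewrite cardU => le_ex.
apply: leq_trans (leq_mul (leqnn _) le_ex); rewrite -expnMn; apply: leq_exp2rW.
apply: ltnW; apply: leq_trans (ltn_ceil n (isT : 0 < d)) _.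
have le2 : (n %/ d).+1 <= 2 * (n %/ d) by lia.
by rewrite [2 * d]mulnC -mulnA mulnC leq_mul2l le2 orbT.
Qed.

Lemma tree_card_gt1 (V : finType) (H : sgraph V) :
  no_isolated H -> is_tree H -> 1 < #|V|.
Proof.
move=> isoH [[/card_gt0P[x _] _] _]; have [y /adj_neq xy] := isoH x.
by rewrite -cardsT; apply/card_gt1P; exists x, y; rewrite !inE xy.
Qed.

(** An extremal graph has enough copies to contain a blow-up, which inherits its [H]-freeness. *)
Lemma U_set_of_leq_ex_number (VT VH : finType) (T : sgraph VT) (H : sgraph VH)
    (Gamma : {set {set VT}}) (c n0 : nat) :
  no_isolated H -> is_tree H -> edge_cover T Gamma ->
  (forall n, n0 <= n -> n ^ #|Gamma| <= c * ex_number n T H) ->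
  exists U, U_set T Gamma U /\ ~~ contains H (blowup T U #|VH|).
Proof.
move=> isoH treeH covG le_ex.
have [n1 many] := blowup_of_many_embeddings c treeH (tree_card_gt1 isoH treeH) covG.
(* The successor makes [n] positive, which forces [ex_number n T H] to be positive. *)
pose n := (n0 + n1).+1; have {}le_ex := le_ex n (leqW (leq_addr _ _)).
have [|G freeG exE] := @ex_number_witness VT VH n T H.
  by rewrite lt0n; apply: contraTneq le_ex => ->; rewrite muln0 -ltnNge expn_gt0.
have [||U UG UinG] := many 'I_n G _ freeG.
- by rewrite card_ord leqW // leq_addl.
- by rewrite card_ord -exE.
by exists U; split=> //; apply: contra freeG => /contains_trans; apply.
Qed.

(* Asymptotic notation and the equivalence *)
From mathcomp Require Import all_boot all_order all_algebra.
From mathcomp Require Import all_classical all_reals all_analysis.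
Import numFieldNormedType.Exports.
Import Order.POrderTheory GRing.Theory Num.Theory.
Local Open Scope classical_set_scope.

Lemma eqThetaOO {K : realType} (f g : nat -> K^o) :
  (f =Theta_\oo g) <-> (f =O_\oo g) /\ (g =O_\oo f).
Proof. by rewrite eqThetaE bigThetaE eqOmegaO. Qed.

Lemma eqO_natP {K : realType} (f g : nat -> nat) :
  ((fun n => (f n)%:R%R : K^o) =O_\oo (fun n => (g n)%:R%R : K^o)) <->
  exists c n0 : nat, forall n, (n0 <= n -> f n <= c * g n)%N.
Proof.
rewrite eqO_exP; split=> [[k k0 [n0 _ fg]]|[c [n0 fg]]].
  exists (Num.bound k), n0 => n /fg /=.
  rewrite !ger0_norm ?ler0n // -(ler_nat K) natrM => /le_trans; apply.
  rewrite ler_wpM2r ?ler0n //.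
  by apply/ltW/archi_boundP/ltW.
(* A Landau constant must be positive, hence the successor. *)
exists (c.+1%:R)%R; first by rewrite ltr0n.
exists n0 => // n /fg fgn /=.
rewrite !ger0_norm ?ler0n // -natrM ler_nat.
by apply: leq_trans fgn _; rewrite leq_mul2r leqnSn orbT.
Qed.

Theorem theorem1p8 (R : realType) (VT VH : finType) (T : sgraph VT) (H : sgraph VH)
  (T_no_isolated : no_isolated T) (T_bipartite : bipartite T)
  (H_no_isolated : no_isolated H) (H_tree : is_tree H) :
  [<-> (fun n : nat => (ex_number n T H)%:R%R : R^o)
         =Theta_\oo (fun n : nat => (n%:R ^+ independence_number T)%R : R^o);
       forall Gamma : {set {set VT}}, min_edge_cover T Gamma ->
         exists U : {set VT}, U_set T Gamma U /\ ~~ contains H (blowup T U #|VH|);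
       exists Gamma : {set {set VT}}, min_edge_cover T Gamma /\
         exists U : {set VT}, U_set T Gamma U /\ ~~ contains H (blowup T U #|VH|)].
Proof.
have alphaE := card_min_edge_cover T_no_isolated T_bipartite.
have -> : (fun n : nat => (n%:R ^+ independence_number T)%R : R^o) =
    (fun n : nat => (n ^ independence_number T)%N%:R%R : R^o).
  by apply/funext => n; rewrite natrX.
tfae.
(* All minimum covers have [independence_number T] edges, so one lower bound serves each of them. *)
- move=> /eqThetaOO[_ /eqO_natP[c [n0 le_ex]]] Gamma minG.
  apply: (@U_set_of_leq_ex_number _ _ T H Gamma c n0) => //; first exact: minG.1.
  by move=> n /le_ex; rewrite (alphaE _ minG).
- move=> allG; have [Gamma minG] := min_edge_cover_exists T_no_isolated T_bipartite.
  by exists Gamma; split=> //; apply: allG.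
(* The upper bound comes from the linear number of arcs, the lower one from blow-ups with linearly
   many layers. *)
- move=> [Gamma [minG [U [UG freeU]]]]; apply/eqThetaOO; split; apply/eqO_natP.
    exists ((2 * #|VH|) ^ independence_number T)%N, 0%N => n _.
    exact: leq_ex_number_pow.
  exists ((2 * #|VT|.+1) ^ independence_number T)%N, #|VT|.+1 => n lt_n.
  by rewrite -(alphaE _ minG); exact: leq_pow_ex_number H_no_isolated UG freeU n lt_n.
Qed.
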